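(* For $n\ge 3$ the field $\tilde T_n$ is generated over $\tilde T_{n-1}$ by adjoining all the elements $u_c$ with $c\in K_-^{\,n-2}$.
   Context: Let $p$ be an odd prime, $K=\mathbb{F}_{p^2}$, and $K_-=\{\alpha\in K:\alpha^p=-\alpha\}$. Put $g(x)=x^{p+1}/(x^p+x)\in\mathbb{F}_p(x)$. Let $T_1=K(x_1)$ be the rational function field, and, inside a fixed separable closure $\Omega$ of $T_1$, define recursively $T_m=K(x_1,\dots,x_m)$, where $x_{i+1}$ is a root of $x_{i+1}^p+x_{i+1}=g(x_i)$. Let $\tilde T_n\subset\Omega$ be the Galois closure of $T_n$ over $T_1$. Elements $u_c\in\Omega$: for $c=c_1\in K_-$, $u_{c_1}$ denotes a (chosen) root of $X^p+X-g(x_2+c_1)$; for $m\ge2$ and $c=(c_1,\dots,c_m)\in K_-^m$, with $c'=(c_1,\dots,c_{m-1})$, $u_c$ denotes a (chosen) root of $X^p+X-g(u_{c'}+c_m)$. *)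

(* Defs.v *)
From HB Require Import structures.
From mathcomp Require Import all_boot all_order all_algebra all_field.
From mathcomp Require Import boolp classical_sets.

Set Implicit Arguments.
Unset Strict Implicit.
Unset Printing Implicit Defensive.

Import GRing.Theory.

Local Open Scope classical_set_scope.
Local Open Scope ring_scope.

Definition is_subfield (L : fieldType) (E : set L) : Prop :=
  [/\ E 1, (forall y z, E y -> E z -> E (y - z)) &
      (forall y z, E y -> E z -> E (y / z))].

Definition field_gen (L : fieldType) (S : set L) : set L :=
  smallest (@is_subfield L) S.

Definition adjoin (L : fieldType) (E S : set L) : set L :=
  field_gen (E `|` S).

(* The extension L / F given by iota may have infinite degree, which rules out
   fieldExtType and the predicates of the file galois. *)

Definition separable_over (F L : fieldType) (iota : {rmorphism F -> L})
    (y : L) : Prop :=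
  exists f : {poly F},
    [/\ irreducible_poly f, separable_poly f & root (map_poly iota f) y].

Definition separably_closed (L : fieldType) : Prop :=
  forall f : {poly L},
    separable_poly f -> (1 < size f)%N -> exists y, root f y.

Definition is_separable_closure (F L : fieldType)
    (iota : {rmorphism F -> L}) : Prop :=
  (forall y : L, separable_over iota y) /\ separably_closed L.

Definition is_intermediate (F L : fieldType) (iota : {rmorphism F -> L})
    (E : set L) : Prop :=
  is_subfield E /\ range iota `<=` E.

Definition normal_over (F L : fieldType) (iota : {rmorphism F -> L})
    (E : set L) : Prop :=
  forall f : {poly F}, irreducible_poly f ->
    (exists2 y, E y & root (map_poly iota f) y) ->
    exists2 rs : seq L, (forall r, r \in rs -> E r) &
      map_poly iota f %= \prod_(r <- rs) ('X - r%:P).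

Definition galois_over (F L : fieldType) (iota : {rmorphism F -> L})
    (E : set L) : Prop :=
  [/\ is_intermediate iota E, (forall y, E y -> separable_over iota y) &
      normal_over iota E].

Definition galois_closure (F L : fieldType) (iota : {rmorphism F -> L})
    (E : set L) : set L :=
  smallest (galois_over iota) E.

(* The value at y of x^(p+1) / (x^p + x); the elements y it is used at below
   are transcendental over the constants, so that the denominator is nonzero. *)
Definition g (L : fieldType) (p : nat) (y : L) : L :=
  y ^+ p.+1 / (y ^+ p + y).

Definition Kminus (K : fieldType) (p : nat) : {pred K} :=
  [pred a : K | a ^+ p == - a].

Arguments Kminus K p : clear implicits.

Definition Kminus_pow (K : fieldType) (p m : nat) : set (seq K) :=
  [set c | size c = m /\ all (Kminus K p) c].

Arguments Kminus_pow K p m : clear implicits.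

Definition const (K L : fieldType) (iota : {rmorphism {fraction {poly K}} -> L})
    (a : K) : L :=
  iota (tofrac a%:P).

(* Indices start at 1; the value x 0 is irrelevant. *)
Definition is_tower (K L : fieldType)
    (iota : {rmorphism {fraction {poly K}} -> L}) (p : nat)
    (x : nat -> L) : Prop :=
  x 1%N = iota (tofrac 'X) /\
  (forall i, (1 <= i)%N -> x i.+1 ^+ p + x i.+1 = g p (x i)).

Definition T (K L : fieldType) (iota : {rmorphism {fraction {poly K}} -> L})
    (x : nat -> L) (m : nat) : set L :=
  adjoin (range (const iota)) [set x i | i in [set i | (1 <= i <= m)%N]].

(* A tuple (c_1, ..., c_m) is the sequence [:: c_1; ...; c_m], so that
   rcons c a is the tuple with truncation c and last entry a. *)
Definition is_root_choice (K L : fieldType)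
    (iota : {rmorphism {fraction {poly K}} -> L}) (p : nat)
    (x : nat -> L) (u : seq K -> L) : Prop :=
  (forall a, a \in Kminus K p ->
     u [:: a] ^+ p + u [:: a] = g p (x 2%N + const iota a)) /\
  (forall m c a, (1 <= m)%N -> Kminus_pow K p m c -> a \in Kminus K p ->
     u (rcons c a) ^+ p + u (rcons c a) = g p (u c + const iota a)).

(* Main.v *)
From HB Require Import structures.
Require Import Defs.
From mathcomp Require Import all_boot all_order all_algebra all_field.
From mathcomp Require Import boolp classical_sets.
From mathcomp Require Import zify ring.

Set Implicit Arguments.
Unset Strict Implicit.
Unset Printing Implicit Defensive.

Import GRing.Theory.

Local Open Scope classical_set_scope.
Local Open Scope ring_scope.

(** Call ends of level m all the values that x_m can take when x_1 is fixed and
    the roots of X^p + X = g(x_i) are chosen freely at each step. For m >= 3 the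
    ends of level m are, up to constants of K_-, the elements u_c with c in
    K_-^(m-2) ([root_choice_in_ends], [ends_root_choice]). The theorem thus says
    that the Galois closure of T_n arises from that of T_(n-1) by adjoining the
    ends of level n. It rests on the fact that these ends are exactly the
    conjugates of x_n over K(x_1) ([tower_ends_polynomial]).

    To see this, put S = 1/x_1 and y = 1/x. Since g(1/w) = 1/(w^p + w), the
    relation x'^p + x' = g(x) becomes y^p + y = g(y') ([g_reciprocity]). Starting
    from Q_1(Y) = Y - S, monic polynomials Q_m over K[S] whose roots are the
    inverses of the ends of level m are built by recursion. The product of the
    translates Q_m(b - c), for c in K_-, is invariant under the translations by
    K_-, so it is a polynomial N in b^p + b ([translation_invariant]); then
    Q_(m+1)(Y) is N(g(Y)) cleared of its denominator. Each Q_m is Eisenstein at S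
    ([eisenstein_step]), which expresses that the pole of x_1 is totally ramified
    in the tower. Hence Q_m is irreducible over K(x_1)
    ([eisenstein_irreducible]).

    A normal extension containing x_n therefore contains all the ends of level n,
    in particular the u_c; this gives one inclusion. For the other, the field M
    generated by the u_c over the Galois closure of T_(n-1) contains all the
    ends of level n, hence x_n, and it must be shown to be normal. The elements
    whose conjugates all lie in M form a subfield ([conjugates_in_subfield]):
    the conjugates of y - z and y / z are differences and quotients of conjugates
    of y and z, as resultants show. This subfield contains the generators of M,
    so it contains M. *)

(** * Eisenstein polynomials over K[S] *)

(** The Eisenstein condition at the prime S, with the valuation-one condition
    on the constant coefficient read off its derivative at S = 0. *)
Definition eisenstein (K : fieldType) (Q : {poly {poly K}}) : Prop :=
  [/\ Q \is monic, (1 < size Q)%N,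
      map_poly (horner_eval 0) Q = 'X^((size Q).-1) &
      (Q`_0)^`().[0] != 0].

Lemma map_horner0_eq0 (K : fieldType) (h : {poly {poly K}}) :
  map_poly (horner_eval 0) h = 0 ->
  exists2 h' : {poly {poly K}}, h = 'X *: h' & size h' = size h.
Proof.
move=> h0.
have Dh : h = 'X *: map_poly (fun a : {poly K} => a %/ 'X) h.
  apply/polyP=> i; rewrite coefZ coef_map_id0 ?div0p // mulrC divpK //.
  have : 'X - 0%:P %| h`_i.
    by rewrite dvdp_XsubCl rootE -[_.[0]]/(horner_eval 0 _) -coef_map h0 coef0.
  by rewrite subr0.
exists (map_poly (fun a : {poly K} => a %/ 'X) h) => //.
by rewrite {2}Dh size_scale // polyX_eq0.
Qed.

(** Gauss's lemma at the prime S: if S divides c, it divides one of the two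
    factors, since K[Y] is a domain; cancelling S repeatedly makes c prime
    to S. *)
Lemma primitive_factors (K : fieldType) (Q h f : {poly {poly K}}) (c : {poly K}) :
  c != 0 -> h * f = c *: Q ->
  exists h' f' c', [/\ c'.[0] != 0, h' * f' = c' *: Q,
    size h' = size h & size f' = size f].
Proof.
have [n] := ubnP (size c); elim: n c h f => // n IHn c h f ltcn nz_c Dhf.
have [c0|nz_c0] := eqVneq c.[0] 0; last by exists h, f, c.
have [c' Dc] : exists c', c = c' * 'X.
  have /factor_theorem[c'] : root c 0 by apply/rootP.
  by rewrite subr0; exists c'.
have nz_c' : c' != 0 by apply: contraNneq nz_c => c'0; rewrite Dc c'0 mul0r.
have ltc'n : (size c' < n)%N by move: ltcn; rewrite Dc size_mulX.
have nzX : 'X != 0 :> {poly K} by rewrite polyX_eq0.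
have : map_poly (horner_eval 0) h * map_poly (horner_eval 0) f = 0.
  rewrite -rmorphM /= Dhf; apply/polyP=> i.
  by rewrite coef_map coefZ coef0 /= /horner_eval hornerM c0 mul0r.
move/eqP; rewrite mulf_eq0 => /orP[] /eqP/map_horner0_eq0[k Dk <-].
  apply: IHn ltc'n nz_c' _; apply: (@mulfI _ 'X%:P); rewrite ?polyC_eq0 // !mul_polyC.
  by rewrite scalerAl -Dk Dhf Dc mulrC scalerA.
apply: IHn ltc'n nz_c' _; apply: (@mulfI _ 'X%:P); rewrite ?polyC_eq0 // !mul_polyC.
by rewrite scalerAr -Dk Dhf Dc mulrC scalerA.
Qed.

(** Modulo S both factors divide a power of Y and keep their degrees. If both
    had positive degree, both constant coefficients would vanish at S = 0, and
    the constant coefficient of c Q would vanish there to order two. *)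
Lemma eisenstein_primitive_factor (K : fieldType) (Q h f : {poly {poly K}})
    (c : {poly K}) :
  eisenstein Q -> c.[0] != 0 -> h * f = c *: Q -> size f != 1%N ->
  size h = 1%N.
Proof.
case=> monQ gtQ1 Q0 dQ c0 Dhf f1.
set ev := horner_eval (0 : K) in Q0.
have nz_c : c != 0 by apply: contraNneq c0 => ->; rewrite horner0.
have nz_hf : h * f != 0 by rewrite Dhf -size_poly_eq0 size_scale // size_poly_eq0 monic_neq0.
have [nz_h nz_f] : h != 0 /\ f != 0 by apply/andP; rewrite -negb_or -mulf_eq0.
have Dev : map_poly ev h * map_poly ev f = c.[0] *: 'X^((size Q).-1).
  rewrite -rmorphM /= Dhf -Q0; apply/polyP=> i.
  by rewrite !(coef_map, coefZ) /= /ev /horner_eval hornerM.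
have nz_ev : map_poly ev h * map_poly ev f != 0.
  by rewrite Dev -size_poly_eq0 size_scale // size_polyXn.
have [nz_eh nz_ef] : map_poly ev h != 0 /\ map_poly ev f != 0.
  by apply/andP; rewrite -negb_or -mulf_eq0.
have le_size (k : {poly {poly K}}) : (size (map_poly ev k) <= size k)%N.
  by apply: size_poly.
have sz : (size h + size f).-1 = size Q.
  by rewrite -size_mul // Dhf size_scale.
have sz' : (size (map_poly ev h) + size (map_poly ev f)).-1 = size Q.
  by rewrite -size_mul // Dev size_scale // size_polyXn prednK // ltnW.
have [szh szf] : size (map_poly ev h) = size h /\ size (map_poly ev f) = size f.
  move: (le_size h) (le_size f) sz sz' nz_eh nz_ef.
  rewrite -!size_poly_gt0; move: (size h) (size f) (size (map_poly _ _)).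
  move=> a b d; move: (size _) (size _) => e q ? ? ? ? ? ?; lia.
have root0 (k : {poly {poly K}}) : map_poly ev k %| 'X^((size Q).-1) ->
    size k = size (map_poly ev k) -> size k != 1%N -> (k`_0).[0] = 0.
  have XE : 'X = 'X - 0%:P :> {poly K} by rewrite subr0.
  rewrite {1}XE => /dvdp_exp_XsubCP[[|i] _ Dk] ->.
    by rewrite (eqp_size Dk) size_poly1.
  move=> _; have : root (map_poly ev k) 0.
    by rewrite (eqp_root Dk) -XE rootE hornerXn expr0n.
  by move/rootP; rewrite horner_coef0 coef_map; apply.
have ehQ : map_poly ev h %| 'X^((size Q).-1).
  by rewrite -(dvdpZr _ _ c0) -Dev dvdp_mulr.
have efQ : map_poly ev f %| 'X^((size Q).-1).
  by rewrite -(dvdpZr _ _ c0) -Dev dvdp_mull.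
apply/eqP; apply: contraNT dQ => h1.
have h0 := root0 h ehQ (esym szh) h1; have f0 := root0 f efQ (esym szf) f1.
have Q00 : (Q`_0).[0] = 0.
  have := congr1 (fun q : {poly K} => q`_0) Q0.
  rewrite coef_map coefXn /= /ev /horner_eval => ->.
  by case: (size Q) gtQ1 => [|[|]].
have /(congr1 (fun q : {poly K} => q^`().[0])) : h`_0 * f`_0 = c * Q`_0.
  by rewrite -coef0M Dhf coefZ.
rewrite !derivM !hornerE h0 f0 Q00.
by rewrite !(mulr0, mul0r, add0r) => /esym/eqP; rewrite mulf_eq0 (negPf c0).
Qed.

Lemma clear_denominators (K F : fieldType) (phi : {rmorphism {poly K} -> F}) :
  injective phi ->
  (forall z : F, exists a b, b != 0 /\ phi b * z = phi a) ->
  forall f : {poly F}, exists f' c, c != 0 /\ map_poly phi f' = phi c *: f.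
Proof.
move=> inj_phi frac_phi; elim/poly_ind=> [|f z [f' [c [nz_c Df']]]].
  by exists 0, 1; rewrite oner_neq0 rmorph0 scaler0.
have [a [b [nz_b Da]]] := frac_phi z.
exists (b *: f' * 'X + (c * a)%:P), (c * b); split; first by rewrite mulf_neq0.
rewrite rmorphD /= map_polyC [map_poly phi (_ * _)]rmorphM /= map_polyX map_polyZ Df' /=.
rewrite [phi (c * a)]rmorphM [phi (c * b)]rmorphM /= -Da scalerDr.
rewrite -!scalerAl scalerA (mulrC (phi b)); congr (_ + _).
by rewrite -mul_polyC -polyCM mulrA.
Qed.

(** The two hypotheses on phi say that F is a fraction field of K[S]. Keeping
    phi abstract allows the prime S to be sent to the inverse of the coordinate
    of a rational function field. *)
Lemma eisenstein_irreducible (K F : fieldType)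
    (phi : {rmorphism {poly K} -> F}) :
  injective phi ->
  (forall z : F, exists a b, b != 0 /\ phi b * z = phi a) ->
  forall Q, eisenstein Q -> irreducible_poly (map_poly phi Q).
Proof.
move=> inj_phi frac_phi Q eisQ; have [monQ gtQ1 _ _] := eisQ.
have phi0 a : (phi a == 0) = (a == 0) by rewrite -(inj_eq inj_phi) rmorph0.
have sz_phi q : size (map_poly phi q) = size q.
  by apply: size_map_inj_poly => //; rewrite rmorph0.
split=> [|f f1 /dvdpP[h Dhf]]; first by rewrite sz_phi.
have [f' [cf [nz_cf Df]]] := clear_denominators inj_phi frac_phi f.
have [h' [ch [nz_ch Dh]]] := clear_denominators inj_phi frac_phi h.
have Dhf' : h' * f' = (ch * cf) *: Q.
  apply: (map_inj_poly inj_phi (rmorph0 phi)).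
  rewrite rmorphM /= Df Dh map_polyZ Dhf /= rmorphM /=.
  by rewrite -scalerAl -scalerAr scalerA.
have nz_c : ch * cf != 0 by rewrite mulf_neq0.
have [h2 [f2 [c2 [nz_c2 Dhf2 sh sf]]]] := primitive_factors nz_c Dhf'.
have sh' : size h' = size h by rewrite -sz_phi Dh size_scale // phi0.
have sf' : size f' = size f by rewrite -sz_phi Df size_scale // phi0.
have := eisenstein_primitive_factor eisQ nz_c2 Dhf2.
rewrite sh sf sh' sf' => /(_ f1)/eqP/size_poly1P[k nz_k Dk].
by rewrite Dhf Dk mul_polyC eqp_sym eqp_scale.
Qed.

(** * The additive polynomial X^p + X *)

Lemma size_XpX (p : nat) (R : nzRingType) :
  (1 < p)%N -> size ('X^p + 'X : {poly R}) = p.+1.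
Proof. by move=> p1; rewrite size_polyDl size_polyXn // size_polyX ltnS. Qed.

Lemma monic_XpX (p : nat) (R : nzRingType) :
  (1 < p)%N -> ('X^p + 'X : {poly R}) \is monic.
Proof.
by move=> p1; rewrite monicE lead_coefDl ?lead_coefXn // size_polyXn size_polyX.
Qed.

(** X^p + X divides (X^p + X)^p - (X^p + X) = X^(p^2) - X, whose roots are the
    elements of K, each simple. *)
Lemma Kminus_split (p : nat) (K : finFieldType) :
  prime p -> #|K| = (p ^ 2)%N ->
  'X^p + 'X = \prod_(c in Kminus K p) ('X - c%:P) :> {poly K}.
Proof.
move=> p_pr cardK; have pcharK := card_finPcharP cardK p_pr.
have pchX : p \in [pchar {poly K}] by rewrite pchar_poly.
have : 'X^p + 'X %| \prod_(x : K) ('X - x%:P).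
  have -> : \prod_x ('X - x%:P) = ('X^p + 'X) ^+ p - ('X^p + 'X) :> {poly K}.
    rewrite -finField_genPoly cardK -(pFrobenius_autE pchX) rmorphD /=.
    by rewrite !pFrobenius_autE -exprM mulnn opprD addrA addrK.
  by rewrite dvdp_sub // dvdp_exp // prime_gt0.
case/dvdp_prod_XsubC=> m Dm; set s := mask m _ in Dm.
have Ds : 'X^p + 'X = \prod_(x <- s) ('X - x%:P) :> {poly K}.
  by apply/eqP; rewrite -eqp_monic ?monic_prod_XsubC ?monic_XpX ?prime_gt1.
have us : uniq s by rewrite mask_uniq // index_enum_uniq.
rewrite Ds -big_enum; apply: perm_big; apply: uniq_perm => //; first exact: enum_uniq.
move=> c; rewrite -root_prod_XsubC -Ds mem_enum !inE rootE !hornerE.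
by rewrite addr_eq0.
Qed.

Lemma Kminus0 (p : nat) (K : fieldType) : prime p -> 0 \in Kminus K p.
Proof. by move=> p_pr; rewrite inE expr0n -[p]prednK ?prime_gt0 //= oppr0. Qed.

Lemma KminusB (p : nat) (K : finFieldType) :
  prime p -> #|K| = (p ^ 2)%N ->
  {in Kminus K p &, forall a b, a - b \in Kminus K p}.
Proof.
move=> p_pr cardK a b; have pcharK := card_finPcharP cardK p_pr.
rewrite !inE -!(pFrobenius_autE pcharK) rmorphB /= => /eqP-> /eqP->.
by rewrite opprB opprK addrC.
Qed.

Lemma XpX_roots (p : nat) (K : finFieldType) (L : fieldType)
    (j : {rmorphism K -> L}) :
  prime p -> #|K| = (p ^ 2)%N ->
  forall y z : L, y ^+ p + y = z ^+ p + z ->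
  exists2 c, c \in Kminus K p & y = z + j c.
Proof.
move=> p_pr cardK y z Dyz.
have pcharL : p \in [pchar L].
  by rewrite (fmorph_pchar j) (card_finPcharP cardK p_pr).
have : root (map_poly j ('X^p + 'X)) (y - z).
  rewrite rmorphD /= map_polyXn map_polyX rootE !hornerE.
  rewrite -(pFrobenius_autE pcharL) rmorphB /= !pFrobenius_autE.
  by rewrite -addrA addrACA Dyz -opprD subrr.
rewrite (Kminus_split p_pr cardK) rmorph_prod /= rootE horner_prod.
case/prodf_eq0=> c Kc; rewrite rmorphB /= map_polyX map_polyC /= !hornerE.
by rewrite subr_eq0 => /eqP Dc; exists c => //; rewrite -Dc addrC subrK.
Qed.

Lemma XpX_shift (p : nat) (K : finFieldType) (R : comNzRingType)
    (j : {rmorphism K -> R}) :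
  prime p -> #|K| = (p ^ 2)%N ->
  forall (c : K) (y : R), c \in Kminus K p ->
  (y + j c) ^+ p + (y + j c) = y ^+ p + y.
Proof.
move=> p_pr cardK c y; rewrite inE => /eqP Dc.
have pcharR : p \in [pchar R].
  by apply: (rmorph_pchar j); apply: card_finPcharP cardK p_pr.
rewrite -(pFrobenius_autE pcharR) rmorphD /= !pFrobenius_autE.
by rewrite addrACA -rmorphXn -rmorphD /= Dc addNr rmorph0 addr0.
Qed.

Lemma card_Kminus (p : nat) (K : finFieldType) :
  prime p -> #|K| = (p ^ 2)%N -> #|Kminus K p| = p.
Proof.
move=> p_pr cardK; have := congr1 (fun q : {poly K} => size q) (Kminus_split p_pr cardK).
by rewrite /= -big_enum size_prod_XsubC -cardE size_XpX ?prime_gt1 // => -[].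
Qed.

(** Divide by m = X^p + X, which is itself invariant. By uniqueness of quotient
    and remainder both are invariant; the remainder has degree less than p and
    takes the same value at 0 and at the p points of K_-, so it is constant,
    and the quotient is treated by induction. *)
Lemma translation_invariant (p : nat) (K : finFieldType) (R : idomainType)
    (j : {rmorphism K -> R}) :
  prime p -> #|K| = (p ^ 2)%N ->
  forall P : {poly R},
    (forall c, c \in Kminus K p -> P \Po ('X + (j c)%:P) = P) ->
  exists N, P = N \Po ('X^p + 'X).
Proof.
move=> p_pr cardK P; have p1 := prime_gt1 p_pr.
set m := 'X^p + 'X; have monm : m \is monic by apply: monic_XpX.
have szm : size m = p.+1 by apply: size_XpX.
have [n] := ubnP (size P); elim: n P => // n IHn P ltPn invP.
have Pqr := Pdiv.RingMonic.rdivp_eq monm P.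
set q := Pdiv.Ring.rdivp P m in Pqr; set r := Pdiv.Ring.rmodp P m in Pqr.
have ltrp : (size r <= p)%N.
  by rewrite -ltnS -szm Pdiv.Ring.ltn_rmodpN0 // monic_neq0.
have shift_m c : c \in Kminus K p -> m \Po ('X + (j c)%:P) = m.
  move=> Kc; rewrite rmorphD /= comp_Xn_poly comp_polyX.
  exact: (XpX_shift (polyC \o j) p_pr cardK).
have inv_qr c : c \in Kminus K p ->
    q \Po ('X + (j c)%:P) = q /\ r \Po ('X + (j c)%:P) = r.
  move=> Kc; set t := 'X + _.
  have ltrt : (size (r \Po t) <= p)%N by rewrite size_comp_poly2 // size_XaddC.
  have Dqm : (q \Po t - q) * m = r - (r \Po t).
    apply/eqP; rewrite mulrBl subr_eq addrAC eq_sym subr_eq addrC -Pqr.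
    by rewrite -{1}(invP c Kc) {1}Pqr rmorphD rmorphM /= shift_m.
  have q0 : q \Po t - q = 0.
    apply: contraTeq (leqnn p) => nz_q; rewrite -ltnNge.
    have : (size ((q \Po t - q) * m)%R <= p)%N.
      by rewrite Dqm (leq_trans (size_polyD _ _)) // geq_max size_polyN ltrp.
    rewrite size_mul // ?monic_neq0 // szm addnS /=.
    move: nz_q; rewrite -size_poly_gt0; case: (size _) => // s _.
    by rewrite addSn ltnNge leq_addl.
  split; first by apply/eqP; rewrite -subr_eq0 q0.
  by apply/esym/eqP; rewrite -subr_eq0 -Dqm q0 mul0r.
have Dr : r = (r.[0])%:P.
  apply/eqP; rewrite -subr_eq0; apply: contraTT (leqnn p) => nz_r; rewrite -ltnNge.
  have inj_j : injective j by apply: fmorph_inj.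
  have roots_r : all (root (r - (r.[0])%:P)) (map j (enum (Kminus K p))).
    apply/allP=> _ /mapP[c Kc ->].
    have [|_ rc] := inv_qr c; first by rewrite -mem_enum.
    by rewrite rootE !hornerE -{2}rc horner_comp !hornerE subrr.
  have := max_poly_roots nz_r roots_r.
  rewrite map_inj_uniq // enum_uniq size_map -cardE (card_Kminus p_pr cardK).
  move=> /(_ isT) ltp; apply: leq_trans ltp _.
  rewrite (leq_trans (size_polyD _ _)) // geq_max size_polyN ltrp size_polyC.
  by rewrite (leq_trans (leq_b1 _)) // ltnW.
have [q0|nz_q] := eqVneq q 0.
  by exists (r.[0])%:P; rewrite Pqr q0 mul0r add0r comp_polyC.
have [|c /inv_qr[]//|N DN] := IHn q.
  apply: leq_trans (ltnSE ltPn).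
  have szqm : size (q * m) = (size q + p)%N.
    by rewrite size_mul // ?monic_neq0 // szm addnS.
  have gt_q : (0 < size q)%N by rewrite size_poly_gt0.
  rewrite Pqr size_polyDl ?szqm; last exact: leq_add gt_q ltrp.
  by rewrite -addn1 leq_add2l ltnW.
exists (N * 'X + (r.[0])%:P).
by rewrite rmorphD rmorphM /= comp_polyX comp_polyC -DN -Dr.
Qed.

(** * Climbing one step of the tower *)

Definition translates_prod (p : nat) (K : finFieldType) (Q : {poly {poly K}}) :
    {poly {poly K}} :=
  \prod_(c in Kminus K p) (Q \Po ('X - (c%:P)%:P)).

Lemma translates_prod_descends (p : nat) (K : finFieldType)
    (Q : {poly {poly K}}) :
  prime p -> #|K| = (p ^ 2)%N ->
  exists N, translates_prod p Q = N \Po ('X^p + 'X).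
Proof.
move=> p_pr cardK; apply: (translation_invariant (j := polyC) p_pr cardK) => a Ka.
rewrite rmorph_prod /= (reindex_onto (fun c => c + a) (fun c => c - a)) /=.
  apply: eq_big => [c|c _]; last first.
    rewrite -comp_polyA; congr (_ \Po _).
    rewrite comp_polyB comp_polyX comp_polyC !polyCD opprD.
    by rewrite addrACA subrr addr0.
  rewrite addrK eqxx andbT; apply/idP/idP => Kc.
    by rewrite -[c](addrK a) KminusB.
  by rewrite -[a]opprK KminusB // -[- a]add0r KminusB // Kminus0.
by move=> c _; rewrite subrK.
Qed.

(** Modulo S the product is (X^p + X)^d, so N reduces to Y^d. Its constant
    coefficient is the product of the values Q(-c), in which the factor c = 0
    has valuation one and the others are units. *)
Lemma translates_prod_norm (p : nat) (K : finFieldType) (Q N : {poly {poly K}}) :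
  prime p -> #|K| = (p ^ 2)%N -> eisenstein Q ->
  translates_prod p Q = N \Po ('X^p + 'X) ->
  eisenstein N /\ size N = size Q.
Proof.
move=> p_pr cardK [monQ gtQ1 Q0 dQ] DN; have p1 := prime_gt1 p_pr.
set ev := horner_eval (0 : K) in Q0.
have p1' : (1 < p.+1)%N by apply: leqW.
have szm (R : nzRingType) := size_XpX R p1.
have monm (R : nzRingType) := monic_XpX R p1.
have monN : N \is monic.
  have : translates_prod p Q \is monic.
    apply: monic_prod => c _; rewrite monicE lead_coef_comp ?size_XsubC //.
    by rewrite lead_coefXsubC expr1n mulr1 -monicE.
  rewrite DN !monicE lead_coef_comp ?szm //.
  by rewrite (monicP (monm {poly K})) expr1n mulr1.
have N0 : map_poly ev N = 'X^((size Q).-1).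
  apply/eqP; rewrite -subr_eq0 -(@comp_poly_eq0 _ _ ('X^p + 'X)) ?szm //.
  rewrite rmorphB /= comp_Xn_poly subr_eq0.
  have -> : 'X^p + 'X = map_poly ev ('X^p + 'X).
    by rewrite rmorphD /= map_polyXn map_polyX.
  rewrite -map_comp_poly -DN rmorph_prod /= rmorphD /= map_polyXn map_polyX.
  rewrite (Kminus_split p_pr cardK) -prodrXl; apply/eqP/eq_bigr => c _.
  rewrite map_comp_poly Q0 comp_Xn_poly rmorphB /= map_polyX map_polyC /=.
  by rewrite /ev /horner_eval hornerC.
have szN : size N = size Q.
  have : size (map_poly ev N) = size N.
    by rewrite size_map_poly_id0 // (monicP monN) /ev /horner_eval hornerC oner_neq0.
  by rewrite N0 size_polyXn => <-; rewrite prednK // ltnW.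
split=> //; split=> //; rewrite ?szN //.
have DN0 : N`_0 = Q`_0 * \prod_(c in Kminus K p | c != 0) Q.[- c%:P].
  have -> : N`_0 = (N \Po ('X^p + 'X)).[0].
    rewrite horner_comp !hornerE expr0n -[p]prednK ?prime_gt0 //=.
    by rewrite horner_coef0.
  rewrite -DN horner_prod (bigD1 0) ?Kminus0 //= horner_comp !hornerE oppr0.
  rewrite horner_coef0; congr (_ * _).
  by apply: eq_bigr => c _; rewrite horner_comp !hornerE.
have Q00 : (Q`_0).[0] = 0.
  have := congr1 (fun q : {poly K} => q`_0) Q0.
  rewrite coef_map coefXn /= /ev /horner_eval => ->.
  by case: (size Q) gtQ1 => [|[|]].
rewrite DN0 derivM hornerD !hornerM Q00 mul0r addr0 mulf_neq0 //.
rewrite horner_prod prodf_seq_neq0; apply/allP=> c _; apply/implyP=> /andP[_ nzc].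
have -> : Q.[- c%:P].[0] = (map_poly ev Q).[ev (- c%:P)] by rewrite horner_map.
rewrite Q0 /ev /horner_eval hornerN hornerC.
by rewrite hornerXn expf_neq0 // oppr_eq0.
Qed.

(** Up to the denominator (1 + Y^(p-1))^d, where d is the degree of N, this is N
    evaluated at g(Y) = Y^p / (1 + Y^(p-1)). *)
Definition g_pullback (p : nat) (R : nzRingType) (N : {poly R}) : {poly R} :=
  \sum_(i < size N) N`_i *: ('X^(p * i) * (1 + 'X^(p.-1)) ^+ ((size N).-1 - i)).

Lemma g_pullback_eisenstein (p : nat) (K : fieldType) (N : {poly {poly K}}) :
  (1 < p)%N -> eisenstein N -> eisenstein (g_pullback p N).
Proof.
move=> p1 [monN gtN1 N0 dN]; rewrite /eisenstein.
case szN: (size N) gtN1 N0 => [|[|d]] // _ /= N0.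
(* The term of index d.+1 has no denominator; it is the leading monomial. *)
have DN' : g_pullback p N = 'X^(p * d.+1) +
   \sum_(i < d.+1) N`_i *: ('X^(p * i) * (1 + 'X^(p.-1)) ^+ (d.+1 - i)).
  rewrite /g_pullback szN big_ord_recr /= addrC subnn mulr1; congr (_ + _).
  have -> : N`_d.+1 = 1 by have /monicP := monN; rewrite lead_coefE szN.
  by rewrite scale1r.
have lt_size : (size (\sum_(i < d.+1)
    N`_i *: ('X^(p * i) * (1 + 'X^(p.-1)) ^+ (d.+1 - i)))%R < (p * d.+1).+1)%N.
  rewrite ltnS; apply: (leq_trans (size_sum _ _ _)).
  apply/bigmax_leqP => i _; apply: leq_trans (size_scale_leq _ _) _.
  apply: leq_trans (size_polyMleq _ _) _; rewrite size_polyXn.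
  have := size_poly_exp_leq (1 + 'X^(p.-1) : {poly {poly K}}) (d.+1 - i).
  have : (size (1 + 'X^(p.-1) : {poly {poly K}})%R <= p)%N.
    rewrite (leq_trans (size_polyD _ _)) // geq_max size_poly1 size_polyXn.
    by rewrite prednK ?leqnn (ltnW p1).
  have := ltn_ord i; move: (size _) (size _) => a b; nia.
have sz : size (g_pullback p N) = (p * d.+1).+1.
  by rewrite DN' size_polyDl size_polyXn.
have p0 : (0 < p)%N by apply: ltnW.
rewrite sz /=; split.
- by rewrite DN' monicE lead_coefDl ?lead_coefXn ?size_polyXn.
- by rewrite ltnS muln_gt0 p0.
- rewrite DN' rmorphD /= map_polyXn rmorph_sum big1 ?addr0 // => i _ /=.
  rewrite map_polyZ /= -[horner_eval _ _]coef_map N0 coefXn ltn_eqF //.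
  by rewrite scale0r.
- have -> // : (g_pullback p N)`_0 = N`_0.
  have p_eq0 : (p == 0)%N = false by rewrite gtn_eqF.
  have p1_eq0 : (p.-1 == 0)%N = false by rewrite -subn1 subn_eq0 leqNgt p1.
  rewrite DN' -horner_coef0 hornerD hornerXn expr0n muln_eq0 p_eq0 add0r.
  rewrite horner_sum big_ord_recl big1 ?addr0 => [|i _].
    rewrite muln0 !hornerE expr0n p1_eq0 /=.
    by rewrite addr0 expr1n !mulr1.
  by rewrite hornerZ hornerM hornerXn expr0n muln_eq0 p_eq0 mul0r mulr0.
Qed.

Lemma g_pullback_horner (p : nat) (L : fieldType) (N : {poly L}) (w : L) :
  (0 < p)%N -> w ^+ p + w != 0 ->
  (g_pullback p N).[w] = (1 + w ^+ p.-1) ^+ (size N).-1 * N.[g p w].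
Proof.
move=> p0 nz_w.
have Dw : w ^+ p + w = w * (1 + w ^+ p.-1).
  by rewrite mulrDr mulr1 -exprS prednK // addrC.
move: nz_w; rewrite Dw mulf_eq0 negb_or => /andP[nz_w nz_w1].
have Dg : g p w = w ^+ p / (1 + w ^+ p.-1).
  by rewrite /g Dw exprS invfM mulrACA mulfV ?mul1r.
rewrite horner_sum [in RHS]horner_coef mulr_sumr; apply: eq_bigr => i _.
have le_i : (i <= (size N).-1)%N.
  by rewrite -ltnS prednK // (leq_ltn_trans _ (ltn_ord i)).
rewrite -[in RHS](subnK le_i) exprD !hornerE Dg expr_div_n -exprM.
have := expf_neq0 i nz_w1; move: (_ ^+ i) => e nz_e.
by rewrite /=; field.
Qed.

(** The roots of Q' are the w with g(w) = z^p + z for some root z of Q: Q' is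
    obtained by taking the norm N of Q along z |-> z^p + z and substituting g.
    Both operations preserve the Eisenstein condition. The solutions z of
    z^p + z = g(w) are the b - c, where b is any one of them. *)
Lemma eisenstein_step (p : nat) (K : finFieldType) (Q : {poly {poly K}}) :
  prime p -> #|K| = (p ^ 2)%N -> eisenstein Q ->
  exists2 Q', eisenstein Q' &
  forall (L : fieldType) (psi : {rmorphism {poly K} -> L}) (w b : L),
    injective psi -> w ^+ p + w != 0 -> b ^+ p + b = g p w ->
    (root (map_poly psi Q') w <->
      exists2 c, c \in Kminus K p & root (map_poly psi Q) (b - psi c%:P)).
Proof.
move=> p_pr cardK eisQ; have [N DN] := translates_prod_descends Q p_pr cardK.
have [eisN szN] := translates_prod_norm p_pr cardK eisQ DN.
exists (g_pullback p N); first exact: g_pullback_eisenstein (prime_gt1 p_pr) eisN.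
move=> L psi w b inj_psi nz_w Dg.
have -> : map_poly psi (g_pullback p N) = g_pullback p (map_poly psi N).
  rewrite /g_pullback size_map_inj_poly ?rmorph0 // rmorph_sum /=.
  apply: eq_bigr => i _; rewrite map_polyZ coef_map; congr (_ *: _).
  by rewrite rmorphM /= map_polyXn rmorphXn rmorphD rmorph1 /= map_polyXn.
rewrite rootE g_pullback_horner ?prime_gt0 // mulf_eq0 expf_eq0.
have -> : (1 + w ^+ p.-1 == 0) = false.
  apply: contraNF nz_w => /eqP w1.
  by rewrite -[p]prednK ?prime_gt0 // exprS addrC -{1}[w]mulr1 -mulrDr w1 mulr0.
rewrite andbF /= -Dg.
have -> : (map_poly psi N).[b ^+ p + b] = (map_poly psi (N \Po ('X^p + 'X))).[b].
  by rewrite map_comp_poly horner_comp rmorphD /= map_polyXn map_polyX !hornerE.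
rewrite -DN rmorph_prod /= horner_prod.
have E c : (map_poly psi (Q \Po ('X - (c%:P)%:P))).[b] =
    (map_poly psi Q).[b - psi c%:P].
  by rewrite map_comp_poly horner_comp rmorphB /= map_polyX map_polyC !hornerE.
split=> [/prodf_eq0[c Kc]|[c Kc rc]]; first by rewrite E; exists c.
by apply/prodf_eq0; exists c => //; rewrite E.
Qed.

(** * Normality inside a separable closure *)

Lemma irreducible_dvd (F L : fieldType) (iota : {rmorphism F -> L})
    (f h : {poly F}) (y : L) :
  irreducible_poly f -> root (map_poly iota f) y -> root (map_poly iota h) y ->
  f %| h.
Proof.
move=> irr_f fy hy; apply: contraTT hy; rewrite -irreducible_poly_coprime // => co.
by apply: coprimep_root fy; rewrite coprimep_map.
Qed.

Lemma irreducible_roots_transfer (F L : fieldType) (iota : {rmorphism F -> L})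
    (f h : {poly F}) (y r : L) :
  irreducible_poly f -> root (map_poly iota f) y -> root (map_poly iota f) r ->
  root (map_poly iota h) y -> root (map_poly iota h) r.
Proof.
move=> irr_f fy fr hy; have /dvdpP[k ->] := irreducible_dvd irr_f fy hy.
by rewrite rmorphM rootM fr orbT.
Qed.

Lemma separable_poly_splits (L : fieldType) (f : {poly L}) :
  separably_closed L -> separable_poly f ->
  exists rs : seq L, f %= \prod_(r <- rs) ('X - r%:P).
Proof.
move=> sepL; have [n] := ubnP (size f); elim: n f => // n IHn f ltfn sepf.
have [le1|gt1] := leqP (size f) 1.
  exists [::]; rewrite big_nil -size_poly_eq1 eqn_leq le1 size_poly_gt0.
  exact: separable_poly_neq0.
have [y /factor_theorem[h Dh]] := sepL f sepf gt1.
move: sepf ltfn gt1; rewrite {}Dh separable_mul => /and3P[seph _ _].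
have nz_h := separable_poly_neq0 seph.
rewrite size_Mmonic ?monicXsubC // size_XsubC addn2 /= => lthn _.
have [rs Dh] := IHn h lthn seph.
by exists (y :: rs); rewrite big_cons mulrC eqp_mul2l ?polyXsubC_eq0.
Qed.

(** The root y also has a separable irreducible polynomial, which f divides, so
    f is separable. *)
Lemma irreducible_splits (F L : fieldType) (iota : {rmorphism F -> L})
    (f : {poly F}) (y : L) :
  is_separable_closure iota -> irreducible_poly f -> root (map_poly iota f) y ->
  exists rs : seq L, map_poly iota f %= \prod_(r <- rs) ('X - r%:P).
Proof.
case=> sep_all sepL irr_f fy; apply: separable_poly_splits => //.
have [f0 [irr_f0 sep_f0 f0y]] := sep_all y.
rewrite separable_map; apply: dvdp_separable sep_f0.
exact: irreducible_dvd irr_f fy f0y.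
Qed.

(** The set of elements all of whose conjugates lie in M. Conjugates are taken
    as roots of a common irreducible polynomial, so that no automorphism of L
    has to be constructed. *)
Definition conjugates_in (F L : fieldType) (iota : {rmorphism F -> L})
    (M : set L) : set L :=
  [set y | forall f : {poly F}, irreducible_poly f -> root (map_poly iota f) y ->
     forall r, root (map_poly iota f) r -> M r].

Lemma normal_overP (F L : fieldType) (iota : {rmorphism F -> L}) (E : set L) :
  is_separable_closure iota ->
  normal_over iota E <-> E `<=` conjugates_in iota E.
Proof.
move=> sepcl; split=> [nE y Ey f irr_f fy r|conjE f irr_f [y Ey fy]].
  have [rs Ers Df] := nE f irr_f (ex_intro2 _ _ y Ey fy).
  by rewrite (eqp_root Df) root_prod_XsubC => /Ers.
have [rs Df] := irreducible_splits sepcl irr_f fy; exists rs => // r rs_r.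
by apply: conjE irr_f fy _ _ => //; rewrite (eqp_root Df) root_prod_XsubC.
Qed.

Lemma coprimep_prod_XsubC (L : fieldType) (p : {poly L}) (rs : seq L) :
  (forall r, r \in rs -> ~~ root p r) ->
  coprimep p (\prod_(r <- rs) ('X - r%:P)).
Proof.
elim: rs => [|r rs IHrs] Hrs; first by rewrite big_nil coprimep1.
rewrite big_cons coprimepMr coprimep_XsubC Hrs ?mem_head //=.
by apply: IHrs => s rs_s; rewrite Hrs // inE rs_s orbT.
Qed.

(** Specialising the second variable to r turns the vanishing resultant into
    that of p(u(X, r)) and q. These two polynomials then have a nontrivial common
    factor, which has a root because q splits. It is used with u = X + Y and
    u = X * Y, for differences and quotients. *)
Lemma resultant_common_root (F L : fieldType) (iota : {rmorphism F -> L})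
    (p q : {poly F}) (u : {poly {poly F}}) (r : L)
    (ev : {rmorphism {poly F} -> L}) :
  (forall h, ev h = (map_poly iota h).[r]) ->
  p != 0 -> q != 0 ->
  (exists rs : seq L, map_poly iota q %= \prod_(s <- rs) ('X - s%:P)) ->
  (1 < size u)%N -> ev (lead_coef u) != 0 ->
  root (map_poly iota (resultant (map_poly polyC p \Po u) (map_poly polyC q))) r ->
  exists2 s, root (map_poly iota q) s & root (map_poly iota p) (map_poly ev u).[s].
Proof.
move=> evE nz_p nz_q [rs Dq] gtu1 ev_u.
have evC : ev \o polyC =1 iota.
  by move=> a; rewrite /= evE map_polyC hornerC.
have lcC (h : {poly F}) : lead_coef (map_poly polyC h) = (lead_coef h)%:P.
  by rewrite lead_coef_map_inj //; apply: polyC_inj.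
have ev_lc (h : {poly F}) : h != 0 -> ev (lead_coef (map_poly polyC h)) != 0.
  by move=> nz_h; rewrite lcC -[ev _]/((ev \o polyC) _) evC fmorph_eq0 lead_coef_eq0.
have evP (h : {poly F}) : map_poly ev (map_poly polyC h) = map_poly iota h.
  by rewrite -map_poly_comp; apply: eq_map_poly.
rewrite /root -evE map_resultant ?ev_lc //; last first.
  by rewrite lead_coef_comp // rmorphM rmorphXn mulf_neq0 ?expf_neq0 // ev_lc.
rewrite resultant_eq0 map_comp_poly !evP => gcd_gt1.
apply: contrapT => no_root.
have : coprimep (map_poly iota p \Po map_poly ev u) (map_poly iota q).
  rewrite (eqp_coprimepr _ Dq) coprimep_prod_XsubC // => s rs_s.
  apply/negP=> ps; apply: no_root; exists s; last first.
    by rewrite -horner_comp; exact: ps.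
  by rewrite -[_ == 0]/(root _ s) (eqp_root Dq) root_prod_XsubC.
by rewrite /coprimep => /eqP gcd1; rewrite gcd1 in gcd_gt1.
Qed.

Lemma conjugates_in_base (F L : fieldType) (iota : {rmorphism F -> L})
    (M : set L) : range iota `<=` M -> range iota `<=` conjugates_in iota M.
Proof.
move=> FM _ [a _ <-] f irr_f fa r fr; apply: FM; exists a => //.
have := irreducible_roots_transfer (h := 'X - a%:P) irr_f fa fr.
rewrite rmorphB /= map_polyX map_polyC /= !root_XsubC eqxx => /(_ isT).
by move/eqP.
Qed.

Lemma irreducible_root0 (F L : fieldType) (iota : {rmorphism F -> L})
    (f : {poly F}) (y : L) :
  irreducible_poly f -> root (map_poly iota f) y -> root (map_poly iota f) 0 ->
  y = 0.
Proof.
move=> irr_f fy f0; have := irreducible_roots_transfer (h := 'X) irr_f f0 fy.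
by rewrite map_polyX !rootE !hornerX eqxx => /(_ isT)/eqP.
Qed.

(** A conjugate r of y - z is a root of the resultant that annihilates the
    differences of conjugates of y and z. Hence r is such a difference
    (s + r) - s, and both terms lie in M; similarly for quotients. *)
Lemma conjugates_in_subfield (F L : fieldType) (iota : {rmorphism F -> L})
    (M : set L) :
  is_separable_closure iota -> is_intermediate iota M ->
  is_subfield (conjugates_in iota M).
Proof.
move=> sepcl [[M1 MB Mdiv] FM]; have [sep_all _] := sepcl.
have conjF := conjugates_in_base FM.
split=> [|y z conj_y conj_z h irr_h hyz r hr|y z conj_y conj_z].
- by apply: conjF; exists 1; rewrite ?rmorph1.
- have [p [irr_p _ py]] := sep_all y; have [q [irr_q _ qz]] := sep_all z.
  have [nz_p nz_q] := (irredp_neq0 irr_p, irredp_neq0 irr_q).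
  have := map_sub_annihilantP nz_p nz_q (rootP py) (rootP qz) => /rootP Rroot.
  have {Rroot} := irreducible_roots_transfer irr_h hyz hr Rroot.
  case/(resultant_common_root (ev := horner_eval r \o map_poly iota)
    (fun=> erefl _) nz_p nz_q (irreducible_splits sepcl irr_q qz)).
  + by rewrite size_XaddC.
  + by rewrite lead_coefXaddC rmorph1 oner_neq0.
  move=> s qs; rewrite rmorphD /= map_polyX map_polyC /= map_polyX /horner_eval.
  rewrite !hornerE => ps; rewrite -[r](addrK s) [r + s]addrC.
  by apply: MB; [apply: conj_y ps | apply: conj_z qs].
have [-> | nz_z] := eqVneq z 0.
  by rewrite invr0 mulr0; apply: conjF; exists 0; rewrite ?rmorph0.
have [-> | nz_y] := eqVneq y 0.
  by rewrite mul0r; apply: conjF; exists 0; rewrite ?rmorph0.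
move=> h irr_h hyz r hr.
have [p [irr_p _ py]] := sep_all y; have [q [irr_q _ qz]] := sep_all z.
have [nz_p nz_q] := (irredp_neq0 irr_p, irredp_neq0 irr_q).
have nz_r : r != 0.
  apply: contraNneq (mulf_neq0 nz_y (invr_neq0 nz_z)) => r0; rewrite r0 in hr.
  by apply/eqP; apply: irreducible_root0 irr_h hyz hr.
have := map_div_annihilantP nz_p nz_q nz_z (rootP py) (rootP qz) => /rootP Rroot.
have {Rroot} := irreducible_roots_transfer irr_h hyz hr Rroot.
case/(resultant_common_root (ev := horner_eval r \o map_poly iota)
  (fun=> erefl _) nz_p nz_q (irreducible_splits sepcl irr_q qz)).
- by rewrite mulrC size_mulX ?polyC_eq0 ?polyX_eq0 // size_polyC polyX_eq0.
- rewrite lead_coefM lead_coefX lead_coefC mul1r /= map_polyX.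
  by rewrite /horner_eval hornerX.
move=> s qs; rewrite rmorphM /= map_polyX map_polyC /= map_polyX /horner_eval.
rewrite !hornerE => ps.
have nz_s : s != 0.
  apply: contraNneq nz_z => s0; rewrite s0 in qs.
  by apply/eqP; apply: irreducible_root0 irr_q qz qs.
rewrite -[r](mulfK nz_s) [r * s]mulrC.
by apply: Mdiv; [apply: conj_y ps | apply: conj_z qs].
Qed.

Lemma field_gen_subfield (L : fieldType) (S : set L) : is_subfield (field_gen S).
Proof.
split=> [A [[]]//|y z Sy Sz A A_S|y z Sy Sz A A_S]; have [[_ AB Adiv] _] := A_S.
  by apply: AB; [apply: Sy | apply: Sz].
by apply: Adiv; [apply: Sy | apply: Sz].
Qed.

Lemma galois_closure_conjugates (F L : fieldType) (iota : {rmorphism F -> L})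
    (E : set L) :
  is_separable_closure iota ->
  galois_closure iota E `<=` conjugates_in iota (galois_closure iota E).
Proof.
move=> sepcl y GEy f irr_f fy r fr M [galM EM].
have [_ _ /(normal_overP _ sepcl) conjM] := galM.
by apply: conjM irr_f fy _ fr; apply: GEy.
Qed.

(** The elements with all conjugates in the adjunction form a subfield; it
    contains E and S, hence the whole adjunction. *)
Lemma galois_adjoin (F L : fieldType) (iota : {rmorphism F -> L}) (E S : set L) :
  is_separable_closure iota -> range iota `<=` E ->
  E `<=` conjugates_in iota E ->
  S `<=` conjugates_in iota (adjoin E S) ->
  galois_over iota (adjoin E S).
Proof.
move=> sepcl FE conjE conjS; have EM : E `<=` adjoin E S.
  by move=> y Ey A [_]; apply; left.
have intM : is_intermediate iota (adjoin E S).
  by split; [apply: field_gen_subfield | apply: subset_trans EM].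
split=> //; first by move=> y _; case: sepcl.
apply/normal_overP => //; apply: smallest_sub.
  exact: conjugates_in_subfield.
move=> y [Ey|/conjS//] f irr_f fy r fr; apply: EM.
exact: (conjE y Ey f irr_f fy r fr).
Qed.

(** * K(X) as the fraction field of K[1/X] *)

(** The prime S of K[S] corresponds to the place X = infinity, at which the
    tower is totally ramified. *)
Definition poly_at_infinity (K : fieldType) : {poly K} -> {fraction {poly K}} :=
  horner_eval (tofrac 'X)^-1 \o map_poly (@tofrac {poly K} \o polyC).

HB.instance Definition _ (K : fieldType) :=
  GRing.RMorphism.copy (@poly_at_infinity K)
    (horner_eval (tofrac 'X)^-1 \o map_poly (@tofrac {poly K} \o polyC)).

Lemma poly_at_infinityC (K : fieldType) (c : K) :
  poly_at_infinity c%:P = tofrac c%:P.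
Proof. by rewrite /poly_at_infinity /= map_polyC /horner_eval hornerC. Qed.

Lemma poly_at_infinityX (K : fieldType) :
  poly_at_infinity 'X = (tofrac 'X)^-1 :> {fraction {poly K}}.
Proof. by rewrite /poly_at_infinity /= map_polyX /horner_eval hornerX. Qed.

Lemma tofracX_neq0 (K : fieldType) : tofrac 'X != 0 :> {fraction {poly K}}.
Proof. by rewrite tofrac_eq0 polyX_eq0. Qed.

(** Multiplication by a power of X reverses the coefficients. *)
Lemma poly_at_infinity_rev (K : fieldType) (a : {poly K}) :
  poly_at_infinity a * tofrac 'X ^+ size a =
  tofrac (\sum_(i < size a) a`_i *: 'X^(size a - i)).
Proof.
rewrite /poly_at_infinity /= /horner_eval horner_poly mulr_suml rmorph_sum /=.
apply: eq_bigr => i _; rewrite -mul_polyC rmorphM rmorphXn /= -mulrA; congr (_ * _).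
have -> : tofrac 'X ^+ size a = tofrac 'X ^+ (size a - i) * tofrac 'X ^+ i
    :> {fraction {poly K}} by rewrite -exprD subnK // ltnW.
rewrite exprVn mulrCA mulVf ?mulr1 //.
by rewrite expf_neq0 ?tofracX_neq0.
Qed.

Lemma poly_at_infinity_inj (K : fieldType) : injective (@poly_at_infinity K).
Proof.
move=> a b Dab; apply/eqP; rewrite -subr_eq0; set d := a - b.
have /eqP : poly_at_infinity d * tofrac 'X ^+ size d = 0.
  by rewrite rmorphB /= Dab subrr mul0r.
rewrite poly_at_infinity_rev tofrac_eq0 => /eqP rev0.
rewrite -lead_coef_eq0 lead_coefE; move: rev0.
case Ds: (size d) => [|s] rev0; first by rewrite nth_default ?Ds.
have /eqP := congr1 (fun q : {poly K} => q`_1) rev0.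
rewrite coef0 coef_sum big_ord_recr /= subSnn coefZ coefXn mulr1.
rewrite big1 ?add0r // => i _; rewrite coefZ coefXn subSn ?(ltnW (ltn_ord i)) //.
by rewrite eqSS eq_sym subn_eq0 leqNgt ltn_ord mulr0.
Qed.

Lemma frac_tofracP (R : idomainType) (z : {fraction R}) :
  exists n d : R, d != 0 /\ tofrac d * z = tofrac n.
Proof.
elim/quotW: z => x; exists (val x).1, (val x).2; split.
  exact: denom_ratioP.
unlock FracField.tofrac; rewrite -[LHS]FracField.pi_mul; apply/eqmodP.
rewrite /= FracField.equivfE /FracField.mulf.
rewrite !numden_Ratio ?(mul1r, oner_neq0, denom_ratioP) //.
by rewrite mulr1 mulrC.
Qed.

Lemma poly_at_infinity_frac (K : fieldType) (z : {fraction {poly K}}) :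
  exists a b : {poly K}, b != 0 /\ poly_at_infinity b * z = poly_at_infinity a.
Proof.
have inj := @poly_at_infinity_inj K.
have phi0 b : (poly_at_infinity b == 0) = (b == 0 :> {poly K}).
  by rewrite -(inj_eq inj) rmorph0.
have frac_tofrac (h : {poly K}) :
    exists a b : {poly K}, b != 0 /\ poly_at_infinity b * tofrac h = poly_at_infinity a.
  elim/poly_ind: h => [|h c [a [b [nz_b Da]]]].
    by exists 0, 1; rewrite oner_neq0 !rmorph0 mulr0.
  exists (a + c%:P * b * 'X), (b * 'X).
  split; first by rewrite mulf_neq0 ?polyX_eq0.
  rewrite !(rmorphD, rmorphM) /= poly_at_infinityX poly_at_infinityC -Da.
  rewrite mulrDr mulrACA [X in _ * X]mulrC mulfV ?tofracX_neq0 // mulr1.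
  by rewrite [X in _ + X]mulrC mulrA.
have [n [d [nz_d Dz]]] := frac_tofracP z.
have [an [bn [nz_bn Dn]]] := frac_tofrac n.
have [ad [bd [nz_bd Dd]]] := frac_tofrac d.
have nz_ad : ad != 0.
  by rewrite -phi0 -Dd mulf_neq0 ?phi0 // tofrac_eq0.
exists (an * bd), (ad * bn); split; first by rewrite mulf_neq0.
rewrite !rmorphM /= -Dn -Dd -Dz.
by rewrite [RHS]mulrC -!mulrA; congr (_ * _); rewrite mulrCA.
Qed.

(** * The ends of the tower and their conjugates *)

Lemma XpX_eq_solvable (p : nat) (L : fieldType) (a : L) :
  p \in [pchar L] -> separably_closed L -> exists b : L, b ^+ p + b = a.
Proof.
move=> pcharL sepL; have p1 : (1 < p)%N by apply: prime_gt1; apply: pcharf_prime pcharL.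
have szP : size ('X^p + 'X - a%:P) = p.+1.
  rewrite size_polyDl size_XpX // size_polyN size_polyC.
  by rewrite (leq_ltn_trans (leq_b1 _)) // ltnS ltnW.
have sepP : separable_poly ('X^p + 'X - a%:P).
  rewrite unlock.
  have -> : ('X^p + 'X - a%:P)^`() = 1.
    rewrite !derivE subr0 -mulr_natr -polyC_natr (pcharf0 pcharL) mulr0.
    by rewrite add0r.
  exact: coprimep1.
have [|b] := sepL _ sepP; first by rewrite szP ltnS ltnW.
by rewrite rootE !hornerE subr_eq0 => /eqP; exists b.
Qed.

Lemma g_inv (p : nat) (L : fieldType) (w : L) :
  (0 < p)%N -> g p w^-1 = (w ^+ p + w)^-1.
Proof.
move=> p0; have [->|nz_w] := eqVneq w 0.
  by rewrite invr0 /g exprS !mul0r expr0n gtn_eqF // addr0 invr0.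
rewrite /g -[w ^+ p + w]invrK -invf_div; congr (_^-1).
rewrite invrK !exprVn invrK exprS.
by have := expf_neq0 p nz_w; move: (w ^+ p) => e nz_e; field; rewrite nz_w.
Qed.

(** Passing to inverses turns the tower upside down: this is what lets the
    minimal polynomial of 1/x be computed by the substitution of g. *)
Lemma g_reciprocity (p : nat) (L : fieldType) (x z : L) :
  (0 < p)%N -> (x ^+ p + x = g p z <-> z^-1 ^+ p + z^-1 = g p x^-1).
Proof.
move=> p0; rewrite g_inv // -{1}[z]invrK g_inv //; split=> [->|Dz]; first by rewrite invrK.
by apply: invr_inj; rewrite -Dz invrK.
Qed.

(** The last entries of all sequences of length m + 1 that start at x1 and
    satisfy the equations of the tower, whichever roots are chosen. *)
Fixpoint tower_ends (p : nat) (L : fieldType) (x1 : L) (m : nat) : set L :=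
  if m is m'.+1 then
    [set x | exists2 z, tower_ends p x1 m' z & x ^+ p + x = g p z]
  else [set x1].

(** At a constant c the reduction modulo S forces c = 0, and the constant
    coefficient of Q is nonzero. This keeps the denominators x^p + x away
    from 0, as the roots of X^p + X are constants. *)
Lemma eisenstein_root_nonconstant (K L : fieldType)
    (psi : {rmorphism {poly K} -> L}) (Q : {poly {poly K}}) (c : K) :
  injective psi -> eisenstein Q -> ~~ root (map_poly psi Q) (psi c%:P).
Proof.
move=> inj_psi [_ gtQ1 Q0 dQ]; apply/negP; rewrite rootE horner_map.
rewrite -(rmorph0 psi) (inj_eq inj_psi) => /eqP Qc.
have : (map_poly (horner_eval 0) Q).[horner_eval 0 c%:P] = 0.
  by rewrite horner_map Qc /= /horner_eval horner0.
rewrite Q0 /horner_eval hornerC hornerXn => /eqP.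
rewrite expf_eq0 => /andP[_ /eqP c0]; move: dQ.
by rewrite c0 polyC0 in Qc; rewrite -horner_coef0 Qc deriv0 horner0 eqxx.
Qed.

(** For m = 0 the polynomial is Y - S, because S = 1/x1; the passage from m to
    m + 1 is the Eisenstein step read through the reciprocity of g. *)
Lemma tower_ends_eisenstein (p : nat) (K : finFieldType) (L : fieldType)
    (psi : {rmorphism {poly K} -> L}) (m : nat) :
  prime p -> #|K| = (p ^ 2)%N -> injective psi -> separably_closed L ->
  exists2 Q : {poly {poly K}}, eisenstein Q &
    forall x, tower_ends p (psi 'X)^-1 m x <-> root (map_poly psi Q) x^-1.
Proof.
move=> p_pr cardK inj_psi sepL.
have pcharL : p \in [pchar L].
  apply: (rmorph_pchar (psi \o polyC)); exact: card_finPcharP cardK p_pr.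
elim: m => [|m [Q eisQ endQ]].
  exists ('X - 'X%:P).
    split; rewrite ?monicXsubC ?size_XsubC //.
      by rewrite rmorphB /= map_polyX map_polyC /= /horner_eval hornerX subr0.
    by rewrite coefB coefX coefC /= sub0r derivN derivX !hornerE oppr_eq0 oner_neq0.
  move=> x /=; rewrite rmorphB /= map_polyX map_polyC /= root_XsubC.
  split=> [->|/eqP <-]; first by rewrite invrK.
  by rewrite invrK.
have [Q' eisQ' stepQ] := eisenstein_step p_pr cardK eisQ; exists Q' => // x.
have nonK (P : {poly {poly K}}) y : eisenstein P -> root (map_poly psi P) y ->
    y ^+ p + y != 0.
  move=> eisP Py; apply/eqP=> y0.
  have [|c _ Dy] := XpX_roots (psi \o polyC) p_pr cardK (y := y) (z := 0).
    by rewrite y0 addr0 expr0n gtn_eqF ?prime_gt0.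
  by have /negP := eisenstein_root_nonconstant c inj_psi eisP; rewrite Dy add0r in Py.
split=> [[z /endQ Qz Dx]|Q'x].
  have nz_z := nonK _ _ eisQ Qz; move/(g_reciprocity _ _ (prime_gt0 p_pr)): Dx => Dx.
  apply/(stepQ _ _ _ z^-1) => //; last first.
    by exists 0; rewrite ?Kminus0 // polyC0 rmorph0 subr0.
  apply: contraNneq nz_z => x0.
  by rewrite Dx /g x0 invr0 mulr0.
have nz_x := nonK _ _ eisQ' Q'x.
have [b Db] := XpX_eq_solvable (g p x^-1) pcharL sepL.
have [c Kc Qbc] := (stepQ L psi _ _ inj_psi nz_x Db).1 Q'x.
exists (b - psi c%:P)^-1; first by apply/endQ; rewrite invrK.
apply/(g_reciprocity _ _ (prime_gt0 p_pr)); rewrite invrK -Db -[in RHS](subrK (psi c%:P) b).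
by rewrite (XpX_shift (psi \o polyC) p_pr cardK).
Qed.

(** * Galois closures of the levels *)

Lemma subfieldV (L : fieldType) (E : set L) (y : L) :
  is_subfield E -> E y -> E y^-1.
Proof. by case=> E1 _ Ediv Ey; rewrite -[y^-1]mul1r; apply: Ediv. Qed.

Lemma subfieldD (L : fieldType) (E : set L) (y z : L) :
  is_subfield E -> E y -> E z -> E (y + z).
Proof.
case=> E1 EB _ Ey Ez; rewrite -[z]opprK; apply: (EB _ _ Ey).
by rewrite -[- z]add0r; apply: (EB) => //; rewrite -(subrr 1); apply: EB.
Qed.

(** Irreducibility is the point: the values of tower_ends for a given m
    are all conjugate over K(x1). *)
Lemma tower_ends_polynomial (p : nat) (K : finFieldType) (L : fieldType)
    (iota : {rmorphism {fraction {poly K}} -> L}) (m : nat) :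
  prime p -> #|K| = (p ^ 2)%N -> is_separable_closure iota ->
  exists2 f : {poly {fraction {poly K}}}, irreducible_poly f &
    forall x, tower_ends p (iota (tofrac 'X)) m x <->
              root (map_poly iota f) x^-1.
Proof.
move=> p_pr cardK [_ sepL].
have inj_psi : injective (iota \o @poly_at_infinity K).
  by apply: inj_comp; [apply: fmorph_inj | apply: poly_at_infinity_inj].
have [Q eisQ endQ] := tower_ends_eisenstein m p_pr cardK inj_psi sepL.
exists (map_poly (@poly_at_infinity K) Q).
  apply: eisenstein_irreducible eisQ; first exact: poly_at_infinity_inj.
  exact: poly_at_infinity_frac.
by move=> x; rewrite -map_poly_comp -endQ /= poly_at_infinityX fmorphV invrK.
Qed.

Lemma normal_contains_tower_ends (p : nat) (K : finFieldType) (L : fieldType)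
    (iota : {rmorphism {fraction {poly K}} -> L}) (E : set L) (m : nat) (x : L) :
  prime p -> #|K| = (p ^ 2)%N -> is_separable_closure iota ->
  is_subfield E -> normal_over iota E ->
  tower_ends p (iota (tofrac 'X)) m x -> E x ->
  tower_ends p (iota (tofrac 'X)) m `<=` E.
Proof.
move=> p_pr cardK sepcl fE /(normal_overP _ sepcl) conjE ends_x Ex z ends_z.
have [f irr_f endsP] := tower_ends_polynomial m p_pr cardK sepcl.
rewrite -[z]invrK; apply: subfieldV => //.
by apply: (conjE _ (subfieldV fE Ex) f irr_f); apply/endsP.
Qed.

Lemma tower_ends_conjugates_in (p : nat) (K : finFieldType) (L : fieldType)
    (iota : {rmorphism {fraction {poly K}} -> L}) (M : set L) (m : nat) :
  prime p -> #|K| = (p ^ 2)%N -> is_separable_closure iota ->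
  is_intermediate iota M ->
  tower_ends p (iota (tofrac 'X)) m `<=` M ->
  tower_ends p (iota (tofrac 'X)) m `<=` conjugates_in iota M.
Proof.
move=> p_pr cardK sepcl intM endsM z ends_z; have [fM _] := intM.
have [f _ endsP] := tower_ends_polynomial m p_pr cardK sepcl.
rewrite -[z]invrK; apply: (subfieldV (conjugates_in_subfield sepcl intM)).
move=> h irr_h hz r hr; rewrite -[r]invrK; apply: subfieldV => //; apply: endsM.
apply/endsP; rewrite invrK; apply: (irreducible_roots_transfer irr_h hz hr).
exact/endsP.
Qed.

Lemma tower_in_ends (p : nat) (K L : fieldType)
    (iota : {rmorphism {fraction {poly K}} -> L}) (x : nat -> L) (m : nat) :
  is_tower iota p x -> tower_ends p (x 1%N) m (x m.+1).
Proof.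
by case=> _ x_tower; elim: m => //= m IHm; exists (x m.+1); last exact: x_tower.
Qed.

Lemma const_shift (p : nat) (K : finFieldType) (L : fieldType)
    (iota : {rmorphism {fraction {poly K}} -> L}) (a : K) (y : L) :
  prime p -> #|K| = (p ^ 2)%N -> a \in Kminus K p ->
  (y + const iota a) ^+ p + (y + const iota a) = y ^+ p + y.
Proof.
move=> p_pr cardK Ka.
exact: (XpX_shift (iota \o (@tofrac {poly K} \o polyC)) p_pr cardK).
Qed.

Lemma const_roots (p : nat) (K : finFieldType) (L : fieldType)
    (iota : {rmorphism {fraction {poly K}} -> L}) (y z : L) :
  prime p -> #|K| = (p ^ 2)%N -> y ^+ p + y = z ^+ p + z ->
  exists2 a, a \in Kminus K p & y = z + const iota a.
Proof.
move=> p_pr cardK.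
exact: (XpX_roots (iota \o (@tofrac {poly K} \o polyC)) p_pr cardK).
Qed.

Lemma root_choice_in_ends (p : nat) (K : finFieldType) (L : fieldType)
    (iota : {rmorphism {fraction {poly K}} -> L}) (x : nat -> L) (u : seq K -> L)
    (m : nat) (c : seq K) :
  prime p -> #|K| = (p ^ 2)%N -> is_tower iota p x -> is_root_choice iota p x u ->
  Kminus_pow K p m.+1 c -> tower_ends p (x 1%N) m.+2 (u c).
Proof.
move=> p_pr cardK x_tower [u1 u_rec].
elim: m c => [|m IHm] c [sz_c].
  case: c sz_c => [|a [|]] //= _; rewrite andbT => Ka.
  exists (x 2%N + const iota a); last exact: u1.
  exists (x 1%N); rewrite ?const_shift //; exact: x_tower.2.
case/lastP: c sz_c => // c a; rewrite size_rcons all_rcons => -[sz_c] /andP[Ka Kc].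
have pow_c : Kminus_pow K p m.+1 c by [].
exists (u c + const iota a); last exact: (u_rec m.+1).
have [z ends_z Dz] := IHm c pow_c.
by exists z => //; rewrite const_shift.
Qed.

Lemma ends_root_choice (p : nat) (K : finFieldType) (L : fieldType)
    (iota : {rmorphism {fraction {poly K}} -> L}) (x : nat -> L) (u : seq K -> L)
    (m : nat) (z : L) :
  prime p -> #|K| = (p ^ 2)%N -> is_tower iota p x -> is_root_choice iota p x u ->
  tower_ends p (x 1%N) m.+2 z ->
  exists c a, [/\ Kminus_pow K p m.+1 c, a \in Kminus K p & z = u c + const iota a].
Proof.
move=> p_pr cardK [_ x_tower] [u1 u_rec].
elim: m z => [|m IHm] z [y ends_y Dz].
  have [w /= -> Dy] := ends_y.
  rewrite -x_tower // in Dy; have [a Ka Da] := const_roots iota p_pr cardK Dy.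
  rewrite Da -u1 // in Dz; have [b Kb Db] := const_roots iota p_pr cardK Dz.
  by exists [:: a], b; split=> //; split=> //=; rewrite andbT.
have [c [a [[sz_c Kc] Ka Da]]] := IHm y ends_y.
rewrite Da -(u_rec m.+1) // in Dz.
have [b Kb Db] := const_roots iota p_pr cardK Dz.
exists (rcons c a), b; split=> //; split; first by rewrite size_rcons sz_c.
by rewrite all_rcons Kc andbT.
Qed.

Theorem proposition2p1 (p : nat) (K : finFieldType) (Omega : fieldType)
    (iota : {rmorphism {fraction {poly K}} -> Omega})
    (x : nat -> Omega) (u : seq K -> Omega) (n : nat)
    (p_prime : prime p) (p_odd : odd p) (cardK : #|K| = (p ^ 2)%N)
    (sep_closure : is_separable_closure iota)
    (x_tower : is_tower iota p x)
    (u_choice : is_root_choice iota p x u)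
    (n_ge3 : (3 <= n)%N) :
  galois_closure iota (T iota x n) =
  adjoin (galois_closure iota (T iota x n.-1))
         [set u c | c in Kminus_pow K p (n - 2)].
Proof.
case: n n_ge3 => [|[|[|m]]] // _; rewrite subn2 /=.
have Dx1 := x_tower.1.
have T_x k i : (1 <= i <= k)%N -> T iota x k (x i).
  by move=> le_ik A [_]; apply; right; exists i.
have T_sub : T iota x m.+2 `<=` T iota x m.+3.
  apply: smallest_sub; first exact: field_gen_subfield.
  move=> y [Ky|[i /andP[i1 im] <-]]; first by move=> A [_]; apply; left.
  by apply: T_x; rewrite i1 leqW.
set G := galois_closure _ (T _ _ m.+2); set S := [set u c | c in _].
have S_ends : S `<=` tower_ends p (x 1%N) m.+2.
  move=> _ [c Kc <-].
  exact: root_choice_in_ends p_prime cardK x_tower u_choice Kc.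
apply/seteqP; split.
  have GM : G `<=` adjoin G S by move=> y Gy A [_]; apply; left.
  have SM : S `<=` adjoin G S by move=> y Sy A [_]; apply; right.
  have fM : is_subfield (adjoin G S) by apply: field_gen_subfield.
  have FG : range iota `<=` G by move=> y Fy E [[[_ FE] _ _] _]; apply: FE.
  have constM : range (const iota) `<=` adjoin G S.
    by move=> _ [a _ <-]; apply: GM; apply: (FG); exists (tofrac a%:P).
  have ends_M : tower_ends p (x 1%N) m.+2 `<=` adjoin G S.
    move=> z ends_z.
    have [c [a [Kc Ka ->]]] := ends_root_choice p_prime cardK x_tower u_choice ends_z.
    apply: (subfieldD fM); first by apply: SM; exists c.
    by apply: constM; exists a.
  have TM : T iota x m.+3 `<=` adjoin G S.
    apply: smallest_sub => // y [/constM//|[i /andP[i1 le_im] <-]].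
    move: le_im; rewrite leq_eqVlt => /predU1P[->|le_im].
      exact: ends_M (tower_in_ends m.+2 x_tower).
    by apply: GM; apply: sub_gen_smallest; apply: T_x; rewrite i1 -ltnS.
  apply: smallest_sub => //; apply: galois_adjoin => //.
    exact: galois_closure_conjugates.
  apply: subset_trans S_ends _; rewrite Dx1; apply: tower_ends_conjugates_in => //.
    by split=> //; apply: subset_trans GM.
  by rewrite -Dx1.
move=> y My E [galE TE]; have [[fE _] _ nE] := galE.
apply: My; split=> // z [Gz|Sz].
  by apply: Gz; split=> //; apply: subset_trans TE.
have := normal_contains_tower_ends p_prime cardK sep_closure fE nE.
rewrite -Dx1; apply; last exact: S_ends Sz.
  exact: tower_in_ends m.+2 x_tower.
by apply: TE; apply: T_x; rewrite leqnn.
Qed.
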